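(* Let $G$ be a group and $\{H_\lambda\}_{\lambda\in\Lambda}$ a collection of subgroups of $G$. Suppose that $G$ is finitely presented with respect to $\{H_\lambda\}_{\lambda\in\Lambda}$ and that the relative Dehn function of $G$ with respect to $\{H_\lambda\}_{\lambda\in\Lambda}$ is well-defined. Then the following conditions hold. 1) For any $g_1,g_2\in G$, the intersection $H_\lambda^{g_1}\cap H_\mu^{g_2}$ is finite whenever $\lambda\neq\mu$. 2) The intersection $H_\lambda^{g}\cap H_\lambda$ is finite for any $\lambda \in \Lambda$ and any $g\notin H_\lambda$.
   Context: Notation: $H^g=g^{-1}Hg$. A subset $X\subseteq G$ is a relative generating set of $G$ with respect to $\{H_\lambda\}_{\lambda\in\Lambda}$ if $G$ is generated by $X\cup\bigcup_{\lambda\in\Lambda}H_\lambda$. In this case put $F=(\ast_{\lambda\in\Lambda}\widetilde H_\lambda)\ast F(X)$, where $\widetilde H_\lambda$ is an isomorphic copy of $H_\lambda$ and $F(X)$ is the free group with basis $X$, let $\varepsilon:F\to G$ be the canonical epimorphism, and let $\mathcal H=\bigsqcup_{\lambda\in\Lambda}(\widetilde H_\lambda\setminus\{1\})$. $G$ has the relative presentation $\langle X, H_\lambda,\lambda\in\Lambda \mid R=1, R\in\mathcal R\rangle$, where $\mathcal R$ is a set of words over $X^{\pm1}\cup\mathcal H$ (viewed as elements of $F$), if the kernel of $\varepsilon$ is the normal closure of $\mathcal R$ in $F$; it is assumed that $\mathcal R$ is closed under cyclic shifts and inverses. The relative presentation is finite if both $X$ and $\mathcal R$ are finite. $G$ is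 finitely presented with respect to $\{H_\lambda\}$ if it admits a finite relative presentation. Given a finite relative presentation, a function $f:\mathbb N\to\mathbb N$ is a relative isoperimetric function of it if for every $n$ and every word $W$ over $X^{\pm1}\cup\mathcal H$ of length at most $n$ representing $1$ in $G$, there is an equality $W=\prod_{i=1}^k f_i^{-1}R_if_i$ in $F$ with $R_i\in\mathcal R$, $f_i\in F$ and $k\le f(n)$. The smallest such function is the relative Dehn function of $G$ with respect to $\{H_\lambda\}$; it is called well-defined if it takes a finite value at every $n\in\mathbb N$. (Well-definedness does not depend on the choice of the finite relative presentation.) *)

(* Defs.v *)
From HB Require Import structures.
From mathcomp Require Import all_boot.
From mathcomp Require Import boolp classical_sets cardinality.

Set Implicit Arguments.
Unset Strict Implicit.
Unset Printing Implicit Defensive.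

Local Open Scope quotient_scope.
Local Open Scope classical_set_scope.
Local Open Scope group_scope.

(* A subgroup of a (possibly infinite) group G is a [groupClosed G]. *)

Definition generated (G : groupType) (A : set G) : set G :=
  [set g | forall K : groupClosed G, A `<=` [set` K] -> g \in K].

Definition normal_closure (F : groupType) (A : set F) : set F :=
  [set f | forall N : groupClosed F,
     (forall x y, x \in N -> x ^ y \in N) -> A `<=` [set` N] -> f \in N].

Definition conjugate (G : groupType) (H : groupClosed G) (g : G) : set G :=
  [set g^-1 * h * g | h in [set` H]].

Section RelativeFreeProduct.
Variables (G : groupType) (Lambda : Type) (H : Lambda -> groupClosed G).
Variable X : set G.

Definition nontrivial (l : Lambda) : Type := {h : G | (h \in H l) && (h != 1)}.

(* [Gen x false] stands for x and [Gen x true] for its inverse; the letters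
   [Per h] are tagged by l, which makes the union of the copies of the H_l
   disjoint. *)
Inductive letter : Type :=
| Gen (x : X) (b : bool)
| Per (l : Lambda) (h : nontrivial l).

HB.instance Definition _ := gen_eqMixin letter.
HB.instance Definition _ := gen_choiceMixin letter.

Definition word : Type := seq letter.

Lemma nontrivialV l (h : nontrivial l) :
  ((val h)^-1 \in H l) && ((val h)^-1 != 1).
Proof.
by case: h => h /= /andP[hH h1]; rewrite gpredV hH invg_eq1.
Qed.

Definition inv_letter (a : letter) : letter :=
  match a with
  | Gen x b => Gen x (~~ b)
  | Per l h => Per (exist _ (val h)^-1 (nontrivialV h) : nontrivial l)
  end.

Definition inv_word (w : word) : word := rev (map inv_letter w).

Definition letter_val (a : letter) : G :=
  match a with
  | Gen x b => if b then (val x)^-1 else val x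
  | Per l h => val h
  end.

Definition word_val (w : word) : G := \prod_(a <- w) letter_val a.

(* Equality of words in the free product of the H_l and F(X): the congruence of the free monoid on
   the letters generated by free cancellation in F(X) and by the multiplication
   tables of the H_l, the unit of H_l being the empty word. *)
Inductive word_eq : word -> word -> Prop :=
| word_eq_refl w : word_eq w w
| word_eq_sym u v : word_eq u v -> word_eq v u
| word_eq_trans u v w : word_eq u v -> word_eq v w -> word_eq u w
| word_eq_cat u u' v v' :
    word_eq u u' -> word_eq v v' -> word_eq (u ++ v) (u' ++ v')
| word_eq_gen x b : word_eq [:: Gen x b; Gen x (~~ b)] [::]
| word_eq_mul l (h k m : nontrivial l) :
    val h * val k = val m -> word_eq [:: Per h; Per k] [:: Per m]
| word_eq_one l (h k : nontrivial l) :
    val h * val k = 1 -> word_eq [:: Per h; Per k] [::].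

Lemma word_eqb_equiv : equiv_class_of (fun u v : word => `[< word_eq u v >]).
Proof.
split=> [w|u v|v u w].
- by apply/asboolP; exact: word_eq_refl.
- by apply/asboolP/asboolP; exact: word_eq_sym.
- by move=> /asboolP uv /asboolP vw; apply/asboolP; exact: word_eq_trans vw.
Qed.

Definition word_eqb := EquivRelPack word_eqb_equiv.

Definition relF : Type := {eq_quot word_eqb}.
HB.instance Definition _ := Choice.on relF.
HB.instance Definition _ := EqQuotient.on relF.

Definition of_word (w : word) : relF := \pi_relF w.

Lemma of_wordP (u v : word) : of_word u = of_word v <-> word_eq u v.
Proof.
split=> [/eqmodP/asboolP //|uv].
by apply/eqmodP/asboolP.
Qed.

Lemma word_eq_repr (w : word) : word_eq (repr (of_word w)) w.
Proof. by apply/of_wordP; rewrite /of_word reprK. Qed.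

Definition relF_one : relF := of_word [::].
Definition relF_mul (f g : relF) : relF := of_word (repr f ++ repr g).
Definition relF_inv (f : relF) : relF := of_word (inv_word (repr f)).

Lemma relF_mul_of_word u v :
  relF_mul (of_word u) (of_word v) = of_word (u ++ v).
Proof. by apply/of_wordP/word_eq_cat; exact: word_eq_repr. Qed.

Lemma relF_mulA : associative relF_mul.
Proof.
move=> f g h; rewrite -[f]reprK -[g]reprK -[h]reprK -!/(of_word _).
by rewrite !relF_mul_of_word catA.
Qed.

Lemma relF_mul1 : left_id relF_one relF_mul.
Proof. by move=> f; rewrite -[f]reprK -/(of_word _) relF_mul_of_word. Qed.

Lemma relF_mulr1 : right_id relF_one relF_mul.
Proof. by move=> f; rewrite -[f]reprK -/(of_word _) relF_mul_of_word cats0. Qed.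

Lemma inv_letterK : involutive inv_letter.
Proof.
case=> [x b|l h] /=; first by rewrite negbK.
by congr Per; apply: val_inj => /=; rewrite invgK.
Qed.

Lemma inv_wordK : involutive inv_word.
Proof. by move=> w; rewrite /inv_word map_rev revK (mapK inv_letterK). Qed.

Lemma word_eq_letterV a : word_eq [:: a; inv_letter a] [::].
Proof.
by case: a => [x b|l h]; [exact: word_eq_gen|apply: word_eq_one; exact: mulgV].
Qed.

Lemma word_eqV w : word_eq (w ++ inv_word w) [::].
Proof.
elim/last_ind: w => [|w a IH]; first exact: word_eq_refl.
rewrite /inv_word map_rcons rev_rcons -cats1 -catA.
apply: word_eq_trans IH; apply: word_eq_cat; first exact: word_eq_refl.
exact: (word_eq_cat (word_eq_letterV a) (word_eq_refl (inv_word w))).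
Qed.

Lemma relF_mulV : left_inverse relF_one relF_inv relF_mul.
Proof.
move=> f; rewrite -{2}[f]reprK -/(of_word _) relF_mul_of_word.
by apply/of_wordP; rewrite -{2}[repr f]inv_wordK; exact: word_eqV.
Qed.

Lemma relF_mulrV : right_inverse relF_one relF_inv relF_mul.
Proof.
move=> f; rewrite -{1}[f]reprK -/(of_word _) relF_mul_of_word.
by apply/of_wordP; exact: word_eqV.
Qed.

HB.instance Definition _ := isGroup.Build relF
  relF_mulA relF_mul1 relF_mulr1 relF_mulV relF_mulrV.

Definition eps (f : relF) : G := word_val (repr f).

Lemma word_val_cat u v : word_val (u ++ v) = word_val u * word_val v.
Proof. by rewrite /word_val big_cat. Qed.

Lemma word_val_eq u v : word_eq u v -> word_val u = word_val v.
Proof.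
elim=> {u v} // [u v w _ -> _ -> //|u u' v v' _ IHu _ IHv|x b|l h k m E|l h k E].
- by rewrite !word_val_cat IHu IHv.
- by rewrite /word_val !big_cons !big_nil mulg1; case: b; rewrite /= (mulVg, mulgV).
- by rewrite /word_val !big_cons !big_nil !mulg1.
- by rewrite /word_val !big_cons !big_nil !mulg1.
Qed.

Lemma eps_of_word w : eps (of_word w) = word_val w.
Proof. exact/word_val_eq/word_eq_repr. Qed.

Lemma epsM : {morph eps : f g / f * g}.
Proof. by move=> f g; rewrite [LHS]eps_of_word word_val_cat. Qed.

Lemma eps1 : eps 1 = 1.
Proof. by rewrite [LHS]eps_of_word /word_val big_nil. Qed.

HB.instance Definition _ :=
  isUMagmaMorphism.Build (relF : groupType) G eps (eps1, epsM).

End RelativeFreeProduct.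

Section RelativePresentation.
Variables (G : groupType) (Lambda : Type) (H : Lambda -> groupClosed G).

Record rel_presentation := RelPresentation {
  gens : set G;
  rels : set (word H gens);
  gens_generate :
    generated (gens `|` \bigcup_(l in [set: Lambda]) [set` H l]) = [set: G];
  rels_rot : forall n w, rels w -> rels (rot n w);
  rels_inv : forall w, rels w -> rels (inv_word w);
  ker_eps : [set f : relF H gens | eps f = 1]
            = normal_closure [set of_word w | w in rels]
}.

Definition finite_presentation (P : rel_presentation) : Prop :=
  finite_set (gens P) /\ finite_set (rels (r := P)).

Definition rel_finitely_presented : Prop :=
  exists P : rel_presentation, finite_presentation P.

Definition rel_isoperimetric (P : rel_presentation) (f : nat -> nat) : Prop :=
  forall (n : nat) (W : word H (gens P)),
    (size W <= n)%N -> word_val W = 1 ->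
    exists (k : nat) (c : 'I_k -> relF H (gens P))
           (R : 'I_k -> word H (gens P)),
      [/\ (k <= f n)%N, forall i, rels (R i) &
          of_word W = \prod_(i < k) ((c i)^-1 * of_word (R i) * c i)].

Definition is_rel_Dehn_function (P : rel_presentation) (d : nat -> nat) : Prop :=
  rel_isoperimetric P d /\
  forall f, rel_isoperimetric P f -> forall n, (d n <= f n)%N.

(* Whether the relative Dehn function is finite everywhere does not depend on
   the finite relative presentation. *)
Definition rel_Dehn_well_defined : Prop :=
  exists2 P : rel_presentation,
    finite_presentation P & exists d, is_rel_Dehn_function P d.

End RelativePresentation.

(* Main.v *)
(* Fix [l] and a finite set [S] of elements of G, and let [rho] be the word distance to 1 with
   respect to [S], truncated at a large constant [T] and set to 0 outside [H l].  Along a path in G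
   labelled by a word, sum up the increments of [rho] over the edges labelled by [H l]-letters.
   The sum telescopes on the multiplication table of [H l], so it is defined on the free product
   F, and it is invariant under conjugation of elements of the kernel, up to a change of
   base point.  If [S] contains the letters of the relators, every conjugate of a relator has
   bounded cost, so a word of length at most n representing 1 has cost at most [d n * M], where
   [M] bounds the lengths of the relators.  For h in [H l] with h' = g^-1 h g in [H m], apply this
   to the word h U h'^-1 U^-1, where U is a word for g whose letters are also in [S]: the copies
   of U contribute a bounded amount, and h'^-1 contributes 0, being a letter of another factor
   or an edge in the coset [g H l], disjoint from [H l].  Hence [rho h] is bounded, and h
   lies in a fixed ball of the finite set [S]. *)

Require Import Defs.
From mathcomp Require Import all_boot.
From mathcomp Require Import boolp classical_sets cardinality.
From HB Require Import structures.
From mathcomp Require Import order ssralg ssrnum ssrint lra zify.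

Set Implicit Arguments.
Unset Strict Implicit.
Unset Printing Implicit Defensive.

Import Order.TTheory GRing.Theory Num.Theory.
Local Open Scope classical_set_scope.
Local Open Scope group_scope.

(** * Truncated word distance *)

Section Balls.
Variables (G : groupType) (S : seq G).

Definition ball (n : nat) : seq G :=
  iter n (fun B => [seq x * s | x <- B, s <- S]) [:: 1].

(** Counting the radii below [T] whose ball misses [x] gives the minimum of [T] and the word
    distance once [1] is in [S], as the balls are then nested. *)
Definition trunc_dist (T : nat) (x : G) : nat := \sum_(n < T) (x \notin ball n).

Lemma ball_mulr n x s : x \in ball n -> s \in S -> x * s \in ball n.+1.
Proof. by move=> xB sS; apply/allpairsP; exists (x, s). Qed.

(** If [x] is in ball [i], then [x * s] is in ball [i.+1]: the terms compare after a shift by one,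
    and the term of radius 0 accounts for the [+ 1]. *)
Lemma trunc_dist_mulr T x s :
  s \in S -> (trunc_dist T (x * s) <= trunc_dist T x + 1)%N.
Proof.
move=> sS; case: T => [|T]; first by rewrite /trunc_dist big_ord0.
rewrite /trunc_dist big_ord_recl /= addnC leq_add ?leq_b1 //.
rewrite [leqRHS]big_ord_recr /= (leq_trans _ (leq_addr _ _)) //.
apply: leq_sum => i _; rewrite add0n.
have [xB|_] := boolP (x \in ball i); last exact: leq_b1.
by rewrite (ball_mulr xB sS : _ \in [seq _ | _ <- _, _ <- _]).
Qed.

Lemma trunc_dist1 T : 1 \in S -> trunc_dist T 1 = 0%N.
Proof.
move=> S1; rewrite /trunc_dist big1 // => n _.
suff -> : 1 \in ball n by [].
elim: (n : nat) => [|k IH]; first by rewrite mem_head.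
by rewrite -[1]mulg1 ball_mulr.
Qed.

Lemma trunc_dist_ltP T x :
  (trunc_dist T x < T)%N -> exists n : 'I_T, x \in ball n.
Proof.
move=> lt_T; apply: contrapT => x_out.
move: lt_T; rewrite /trunc_dist (eq_bigr (fun=> 1%N)) => [|n _].
  by rewrite sum_nat_const card_ord muln1 ltnn.
by have [xB|//] := boolP (x \in ball n); case: x_out; exists n.
Qed.

End Balls.

Lemma word_val_letter (G : groupType) (Lambda : Type) (H : Lambda -> groupClosed G)
    (X : set G) (a : letter H X) :
  word_val [:: a] = letter_val a.
Proof. exact: big_seq1. Qed.

(** * Costs of words and of elements of the free product *)

Section Cost.
Variables (G : groupType) (Lambda : Type) (H : Lambda -> groupClosed G).
Variables (X : set G) (l : Lambda) (rho : G -> int).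
Local Notation letter := (letter H X).
Local Notation word := (word H X).
Local Notation relF := (relF H X).

(* As functions of [v], the costs are the Z^G-component of a homomorphism from the free
   product to the wreath product of Z by G. *)
Definition letter_cost (v : G) (a : letter) : int :=
  match a with
  | Gen _ _ => 0%R
  | Per m h => if `[< m = l >] then (rho (v * val h) - rho v)%R else 0%R
  end.

Fixpoint cost (v : G) (w : word) : int :=
  match w with
  | [::] => 0%R
  | a :: w' => (letter_cost v a + cost (v * letter_val a) w')%R
  end.

Lemma cost_cat v (u w : word) :
  cost v (u ++ w) = (cost v u + cost (v * word_val u) w)%R.
Proof.
elim: u v => [|a u IH] v; first by rewrite /word_val big_nil mulg1 add0r.
by rewrite /= IH /word_val big_cons mulgA addrA.
Qed.

Lemma cost_letter v a : cost v [:: a] = letter_cost v a.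
Proof. exact: addr0. Qed.

Lemma cost_word_eq (u w : word) : word_eq u w -> forall v, cost v u = cost v w.
Proof.
elim=> {u w} //= [u w t _ IHu _ IHw v|u u' w w' uu' IHu _ IHw v|m h k t E v|m h k E v].
- by rewrite IHu IHw.
- by rewrite !cost_cat IHu IHw (word_val_eq uu').
- case: asboolP => _; last by rewrite !addr0.
  by rewrite !addr0 -mulgA E; lra.
- case: asboolP => _; last by rewrite !addr0.
  by rewrite !addr0 -mulgA E mulg1; lra.
Qed.

Lemma cost_inv_word v (w : word) :
  cost (v * word_val w) (inv_word w) = (- cost v w)%R.
Proof.
have := cost_word_eq (word_eqV w) v.
by rewrite cost_cat /= addrC => /eqP; rewrite addr_eq0 => /eqP.
Qed.

Definition relF_cost (v : G) (f : relF) : int := cost v (repr f).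

Lemma relF_cost_of_word v (w : word) : relF_cost v (of_word w) = cost v w.
Proof. exact/cost_word_eq/word_eq_repr. Qed.

Lemma relF_costM v (f g : relF) :
  relF_cost v (f * g) = (relF_cost v f + relF_cost (v * eps f) g)%R.
Proof. by rewrite [LHS]relF_cost_of_word cost_cat. Qed.

Lemma relF_cost1 v : relF_cost v 1 = 0%R.
Proof. exact: relF_cost_of_word. Qed.

(** As [r] is a loop, [c] starts where [c^-1] ended, so their costs cancel. *)
Lemma relF_costJ v (r c : relF) : eps r = 1 ->
  relF_cost v (c^-1 * r * c) = relF_cost (v * eps c^-1) r.
Proof.
move=> r1; have := relF_costM v c^-1 c; rewrite mulVg relF_cost1.
rewrite !relF_costM epsM r1 mulg1; lra.
Qed.

Lemma relF_cost_prod v k (f : 'I_k -> relF) : (forall i, eps (f i) = 1) ->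
  relF_cost v (\prod_(i < k) f i) = (\sum_(i < k) relF_cost v (f i))%R.
Proof.
elim: k f => [|k IH] f f1; first by rewrite !big_ord0 relF_cost1.
by rewrite !big_ord_recl relF_costM f1 mulg1 IH.
Qed.

Definition lipschitz_letter (a : letter) : Prop :=
  forall v, (`|letter_cost v a| <= 1)%R.

Lemma cost_le_size v (w : word) : (forall a, a \in w -> lipschitz_letter a) ->
  (`|cost v w| <= (size w)%:Z)%R.
Proof.
elim: w v => [|a w IH] v wL //=.
have := wL a (mem_head _ _) v.
have := IH (v * letter_val a) (fun b bw => wL b (mem_behead (bw : b \in behead (a :: w)))).
by lia.
Qed.

End Cost.

(** * Values of relators and of words *)

Section Presentation.
Variables (G : groupType) (Lambda : Type) (H : Lambda -> groupClosed G).
Variable P : rel_presentation H.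

Lemma word_val_rels (w : word H (gens P)) : rels w -> word_val w = 1.
Proof.
move=> Pw; rewrite -eps_of_word.
suff : [set f : relF H (gens P) | eps f = 1] (of_word w) by [].
by rewrite ker_eps => N _; apply; exists w.
Qed.

Lemma word_val_inv (w : word H (gens P)) : word_val (inv_word w) = (word_val w)^-1.
Proof.
apply/esym/mulg1_eq; rewrite -word_val_cat (word_val_eq (word_eqV w)).
by rewrite /word_val big_nil.
Qed.

Definition represented : {pred G} :=
  fun g => `[< exists w : word H (gens P), word_val w = g >].

Lemma representedP g :
  reflect (exists w : word H (gens P), word_val w = g) (g \in represented).
Proof. exact: asboolP. Qed.

Lemma represented1 : 1 \in represented.
Proof. by apply/representedP; exists [::]; rewrite /word_val big_nil. Qed.

Lemma representedM : {in represented &, forall x y, x * y \in represented}.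
Proof.
move=> _ _ /representedP[u <-] /representedP[w <-].
by apply/representedP; exists (u ++ w); rewrite word_val_cat.
Qed.

Lemma representedV : {in represented, forall x, x^-1 \in represented}.
Proof.
move=> _ /representedP[u <-].
by apply/representedP; exists (inv_word u); rewrite word_val_inv.
Qed.

Lemma word_val_surj g : exists w : word H (gens P), word_val w = g.
Proof.
apply/representedP.
have : [set: G] g by [].
pose K : groupClosed G := HB.pack represented
  (isMul1Closed.Build G represented represented1)
  (isMulClosed.Build G represented representedM)
  (isInvClosed.Build G represented representedV).
rewrite -(gens_generate P) => /(_ K); apply=> x [Px|[l _ /= xH]].
- apply/representedP; exists [:: Gen H (exist _ x (mem_set Px) : gens P) false].
  by rewrite word_val_letter.
- have [->|x1] := eqVneq x 1; first exact: represented1.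
  apply/representedP.
  have xP : (x \in H l) && (x != 1) by rewrite x1 andbT.
  by exists [:: Per (gens P) (exist _ x xP : nontrivial H l)]; rewrite word_val_letter.
Qed.

End Presentation.

(** * Finiteness of the intersections *)

Section Intersection.
Variables (G : groupType) (Lambda : Type) (H : Lambda -> groupClosed G).

Lemma finite_conj_inter (P : rel_presentation H) (d : nat -> nat)
    (l m : Lambda) (g : G) :
  finite_set (rels (r := P)) -> rel_isoperimetric P d ->
  l <> m \/ g \notin H l ->
  finite_set [set h | h \in H l /\ g^-1 * h * g \in H m].
Proof.
move=> /finite_seqP[rs rsE] isoP lm_g.
have [U UE] := word_val_surj P g.
pose A := U ++ flatten rs.
(* The entry [1] makes the distance vanish at 1; the inverses give the second half of the Lipschitz
   bound. *)
pose S := 1 :: map (@letter_val _ _ H (gens P)) A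
            ++ map (fun a : letter H (gens P) => (letter_val a)^-1) A.
have S_A a : a \in A -> letter_val a \in S /\ (letter_val a)^-1 \in S.
  move=> aA; rewrite !in_cons !mem_cat map_f // (map_f (fun b => (letter_val b)^-1)) //.
  by rewrite !orbT.
pose M := \max_(r <- rs) size r.
pose n := size U.
(* One more than the final bound: relators contribute [d (2 + n + n) * M], each of the two copies of
   [U] at most [n]. Hence the truncation is never reached. *)
pose T := (d (2 + n + n) * M + n + n).+1.
pose rho x : int := if x \in H l then Posz (trunc_dist S T x) else 0%R.
have lipA (a : letter H (gens P)) : a \in A -> lipschitz_letter l rho a.
  case: a => [//|p h] aA v /=; have [sS tS] := S_A _ aA.
  case: asboolP => // pl; have hH : val h \in H l by rewrite -pl; case/andP: (valP h).
  (* [v] and [v * val h] lie in [H l] together; outside it both values of [rho] are 0. *)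
  rewrite /rho gpredMr //; case: ifP => _ //.
  have := trunc_dist_mulr T v sS; have := trunc_dist_mulr T (v * val h) tS.
  rewrite mulgK /=.
  by move: (trunc_dist S T v) (trunc_dist S T (v * _)) => t u; lia.
apply: (sub_finite_set (B := \bigcup_(k in `I_T) [set` ball S k])); last first.
  by apply: bigcup_finite => // k _; exact: finite_seq.
move=> h [hl hm]; suff /trunc_dist_ltP[k hk] : (trunc_dist S T h < T)%N.
  by exists (val k) => //=.
(* Letters are nontrivial, so [h = 1] is treated apart. *)
have [->|h1] := eqVneq h 1; first by rewrite trunc_dist1 ?mem_head.
have hlP : (h \in H l) && (h != 1) by rewrite hl.
have hmP : ((g^-1 * h * g)^-1 \in H m) && ((g^-1 * h * g)^-1 != 1).
  rewrite gpredV hm /= invg_eq1; apply: contra h1 => /eqP.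
  by move=> /(congr1 (fun x => g * x * g^-1)); rewrite !mulgA mulgV mul1g mulgK mulg1 mulgV => ->.
pose a : letter H (gens P) := Per (gens P) (exist _ h hlP : nontrivial H l).
pose b : letter H (gens P) := Per (gens P) (exist _ (g^-1 * h * g)^-1 hmP : nontrivial H m).
pose W := [:: a] ++ U ++ [:: b] ++ inv_word U.
have bE : h * g * (g^-1 * h * g)^-1 = g.
  by rewrite !invgM invgK !mulgA mulgK mulgV mul1g.
have sW : (size W <= 2 + n + n)%N.
  by rewrite !size_cat /inv_word size_rev size_map /n /=; lia.
have W1 : word_val W = 1.
  by rewrite !word_val_cat !mulgA word_val_inv UE !word_val_letter bE mulgV.
have [k [c [R [kd RP WE]]]] := isoP _ _ sW W1.
have costW : (`|cost l rho 1 W| <= (d (2 + n + n) * M)%N%:Z)%R.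
  rewrite -relF_cost_of_word WE relF_cost_prod => [|i]; last first.
    by rewrite !epsM (eps_of_word (R i)) (word_val_rels (RP i)) mulg1 -epsM mulVg eps1.
  apply: (le_trans (ler_norm_sum _ _ _)).
  apply: (@le_trans _ _ (\sum_(i < k) M%:Z)%R); last first.
    by rewrite sumr_const card_ord -mulr_natr natz -PoszM lez_nat mulnC leq_mul2r kd orbT.
  apply: ler_sum => i _; have R1 : eps (of_word (R i)) = 1 by rewrite eps_of_word word_val_rels.
  rewrite relF_costJ //.
  have Rrs : R i \in rs by have := RP i; rewrite rsE.
  rewrite relF_cost_of_word; apply: (@le_trans _ _ (size (R i))%:Z%R).
    apply: cost_le_size => x xR; apply: lipA.
    by rewrite mem_cat; apply/orP; right; apply/flattenP; exists (R i).
  by rewrite lez_nat; exact: leq_bigmax_seq.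
have lipU x : x \in U -> lipschitz_letter l rho x.
  by move=> xU; apply: lipA; rewrite mem_cat xU.
have cU v : (`|cost l rho v U| <= n%:Z)%R by exact: cost_le_size.
(* If [m = l], this edge runs from [h * g] to [g], both outside [H l]. *)
have cb : letter_cost l rho (h * g) b = 0%R.
  rewrite /=; case: asboolP => // ml; case: lm_g => [lm|gl]; first by case: lm.
  by rewrite bE /rho (gpredMl _ hl) (negbTE gl) subrr.
have ca : letter_cost l rho 1 a = Posz (trunc_dist S T h).
  rewrite /= asboolT // /rho mul1g hl gpred1 trunc_dist1 ?mem_head //.
  by rewrite subr0.
have : cost l rho 1 W
     = ((trunc_dist S T h)%:Z + cost l rho h U - cost l rho 1 U)%R.
  rewrite !cost_cat !cost_letter !word_val_letter ca !mul1g UE cb add0r bE -UE.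
  (* The edge [b] ends at [g], the endpoint of [U] read from 1, so the last stretch retraces that
     path backwards. *)
  by have := cost_inv_word l rho 1 U; rewrite mul1g => ->; rewrite addrA.
move=> EW; rewrite ltnS.
move: (cU h) (cU 1) costW; rewrite EW.
move: (cost _ _ h U) (cost _ _ 1 U) (trunc_dist S T h) (d _ * M)%N.
move=> x y t K N; lia.
Qed.

End Intersection.

Theorem theorem1p4 (G : groupType) (Lambda : Type)
  (H : Lambda -> groupClosed G)
  (hfp : rel_finitely_presented H) (hDehn : rel_Dehn_well_defined H) :
  (forall (g1 g2 : G) (l m : Lambda), l <> m ->
     finite_set (conjugate (H l) g1 `&` conjugate (H m) g2)) /\
  (forall (l : Lambda) (g : G), g \notin H l ->
     finite_set (conjugate (H l) g `&` [set` H l])).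
Proof.
have [P [_ finR] [d [isoP _]]] := hDehn.
split=> [g1 g2 l m lm|l g gl].
(* Conjugation by [g2^-1] carries the second subgroup back to [H m], which leaves [g1 * g2^-1] as
   the conjugator on [H l]. *)
- have := finite_conj_inter finR isoP (or_introl lm) (g := g1 * g2^-1).
  move=> /(finite_image (fun h => g1^-1 * h * g1)); apply: sub_finite_set.
  move=> _ [[h hl <-] [h' hm E]]; exists h => //; split=> //.
  suff -> : (g1 * g2^-1)^-1 * h * (g1 * g2^-1) = h' by [].
  transitivity (g2 * (g1^-1 * h * g1) * g2^-1); first by rewrite invgM invgK !mulgA.
  by rewrite -E !mulgA mulgV mul1g mulgK.
- have := finite_conj_inter finR isoP (or_intror gl) (m := l).
  move=> /(finite_image (fun h => g^-1 * h * g)); apply: sub_finite_set.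
  by move=> _ [[h hl <-] hgl]; exists h.
Qed.
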